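(* $\operatorname{non}^*_\omega(\mathcal{ED})=\operatorname{cov}(\mathcal M)$.
   Context: $\mathcal{ED}=\{A\subseteq\omega\times\omega:\exists k<\omega\,\forall^\infty n<\omega\ |\{m:\langle n,m\rangle\in A\}|\le k\}$. For an ideal $\mathscr I$ on a countable set $X$, $\operatorname{non}^*_\omega(\mathscr I)=\min\{|\mathcal A|:\mathcal A\subseteq[X]^\omega,\ \forall\overline B\in[\mathscr I]^\omega\,\exists A\in\mathcal A\,\forall B\in\overline B\ |A\cap B|<\omega\}$, where $[Y]^\omega$ is the set of countably infinite subsets of $Y$. $\operatorname{cov}(\mathcal M)$ is the least number of meager sets covering the real line (equivalently $2^\omega$ or $\omega^\omega$). *)

(* Defs.v *)
From HB Require Import structures.
From mathcomp Require Import all_boot all_order all_algebra.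
From mathcomp Require Import all_classical all_reals all_analysis.
Set Implicit Arguments.
Unset Strict Implicit.
Unset Printing Implicit Defensive.
Import numFieldNormedType.Exports.
Local Open Scope card_scope.
Local Open Scope classical_set_scope.

(* A cardinal is given by any type [kappa] having it as cardinality;
   [is_min_card P kappa] reads  kappa = min {|F| : P F}, including the fact
   that the minimum is attained.  It determines [kappa] up to bijection. *)
Definition is_min_card (T : Type) (P : set (set T)) (kappa : Type) : Prop :=
  (exists2 F : set T, P F & F #= [set: kappa]) /\
  (forall F : set T, P F -> [set: kappa] #<= F).

Definition countably_infinite_subsets (T : Type) (Y : set T) : set (set T) :=
  [set A | A `<=` Y /\ A #= [set: nat]].

Definition ED : set (set (nat * nat)) :=
  [set A | exists k : nat,
     \forall n \near \oo, [set m | A (n, m)] #<= `I_k].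

(* Nothing here needs [I] to be an ideal. *)
Definition non_star_omega_family (X : countType) (I : set (set X))
    (F : set (set X)) : Prop :=
  F `<=` countably_infinite_subsets [set: X] /\
  forall BB : set (set X), countably_infinite_subsets I BB ->
    exists2 A, F A & forall B, BB B -> finite_set (A `&` B).

Definition is_non_star_omega (X : countType) (I : set (set X))
    (kappa : Type) : Prop :=
  is_min_card (non_star_omega_family I) kappa.

Definition nowhere_dense (T : topologicalType) (A : set T) : Prop :=
  interior (closure A) = set0.

Definition meager (T : topologicalType) (A : set T) : Prop :=
  exists N : nat -> set T,
    (forall i, nowhere_dense (N i)) /\ A = \bigcup_i N i.

Definition meager_cover (T : topologicalType) (C : set (set T)) : Prop :=
  (forall M, C M -> meager M) /\ \bigcup_(M in C) M = [set: T].

Definition is_cov_meager (T : topologicalType) (kappa : Type) : Prop :=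
  is_min_card (@meager_cover T) kappa.

(* Main.v *)
(* A non-star family F yields a meager cover indexed by F. To x in R attach a
   graph D(x) in ED such that {x | (n, m) in D(x)} meets every fixed interval in a
   set with nonempty interior as soon as n is large. If A in F is infinite with
   finite columns, then {x | A and D(x) meet in a finite set} is meager; these
   sets cover R, by applying the property of F to the sets D(x) + (column j).

   Conversely (after Bartoszynski), suppose that no non-star family has size at
   most |C|. Then any |C| functions nat -> nat are infinitely often guessed by
   countably many functions. This is used twice: to get one increasing sequence
   u that infinitely often outgrows |C| given functions, and to get one function
   g infinitely often equal to each of |C| given infinite partial functions.
   Given meager sets indexed by C, u bounds the search for an interval avoiding
   the first k nowhere dense pieces, and g guesses the result of this search; the
   nested intervals chosen by g shrink to a point outside all the meager sets. *)
Require Import Defs.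
From mathcomp Require Import all_boot all_order all_algebra.
From mathcomp Require Import all_classical all_reals all_analysis.
From mathcomp Require Import lra.
Import numFieldNormedType.Exports.
Import Order.TTheory GRing.Theory Num.Theory.
Local Open Scope card_scope.
Local Open Scope classical_set_scope.

(** * Minimal cardinalities *)

(* Zorn on sets of choice functions for [P] that pairwise differ at every
   member of [P]: a maximal such set is exhausted at some member [F], and it
   injects into every member by evaluation. *)
Lemma exists_min_card (T : Type) (P : set (set T)) :
  P !=set0 -> exists2 F, P F & forall G, P G -> F #<= G.
Proof.
case=> F0 PF0.
pose Q (S : set (set T -> T)) :=
  (forall f F, S f -> P F -> F (f F)) /\
  (forall f g F, S f -> S g -> P F -> f F = g F -> f = g).
have [|S [[S1 S2] Smax]] := @Zorn_bigcup _ Q.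
  move=> Z ZQ tot; split=> [f F [X ZX Xf] PF|f g F [X ZX Xf] [Y ZY Yg] PF].
    by have [h _] := ZQ _ ZX; exact: (h f F).
  have [XY|YX] := tot _ _ ZX ZY.
    by have [_ h] := ZQ _ ZY; apply: (h f g F) => //; apply: XY.
  by have [_ h] := ZQ _ ZX; apply: (h f g F) => //; apply: YX.
have [[F PF FS]|noF] := pselect (exists2 F, P F & F `<=` (fun f => f F) @` S).
  exists F => // G PG.
  apply: card_le_trans (subset_card_le FS) _.
  apply: card_le_trans (card_image_le _ _) _.
  have inj : {in S &, injective (fun f : set T -> T => f G)}.
    by move=> f g /set_mem Sf /set_mem Sg; exact: (S2 f g G).
  have := inj_card_eq inj; rewrite card_eq_le => /andP[_ h].
  apply: card_le_trans h _; apply: subset_card_le => _ [f Sf <-].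
  exact: (S1 f G).
exfalso.
have ex F : P F -> exists2 t, F t & forall f, S f -> f F <> t.
  move=> PF; apply: contrapT => H; apply: noF; exists F => // t Ft.
  apply: contrapT => Ht; apply: H; exists t => // f Sf fFt.
  by apply: Ht; exists f.
have [t0 _ _] := ex _ PF0.
have /choice[c Hc] : forall F, exists t,
    P F -> F t /\ forall f, S f -> f F <> t.
  move=> F.
  have [PF|nPF] := pselect (P F); last by exists t0.
  by have [t Ft Ht] := ex _ PF; exists t.
apply: (Smax (S `|` [set c])); last first.
  split=> [f F [Sf|->] PF|f g F [Sf|->] [Sg|->] PF //].
  - exact: (S1 f F).
  - by have [] := Hc _ PF.
  - exact: (S2 f g F).
  - by move=> e; have [_ /(_ _ Sf)] := Hc _ PF; rewrite e.
  - by move=> e; have [_ /(_ _ Sg)] := Hc _ PF; rewrite e.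
split=> [f Sf|/(_ c (or_intror erefl)) Sc]; first by left.
by have [_ /(_ _ Sc)] := Hc _ PF0.
Qed.

Lemma is_min_card_transfer (T U : Type) (P : set (set T)) (Q : set (set U)) :
  P !=set0 ->
  (forall F, P F -> exists2 G, Q G & G #<= F) ->
  (forall G, Q G -> exists2 F, P F & F #<= G) ->
  exists kappa : Type, is_min_card P kappa /\ is_min_card Q kappa.
Proof.
move=> /exists_min_card[F PF Fmin] PQ QP; exists F.
have FleQ G : Q G -> [set: F] #<= G.
  move=> /QP[F' PF' F'G]; rewrite (card_le_eql (card_setT _)).
  exact: card_le_trans (Fmin _ PF') F'G.
split; split=> //.
- by exists F => //; exact: card_setT_sym.
- by move=> F' PF'; rewrite (card_le_eql (card_setT _)); exact: Fmin.
(* [G] attains the minimum for [Q]: it is no larger than [F], which is below all of [Q]. *)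
have [G QG GF] := PQ _ PF; exists G => //.
rewrite card_eq_le FleQ// (card_le_eqr (card_setT _)).
by rewrite GF.
Qed.

(** * Infinitely-often guessing when small non-star families are absent *)

Definition ex_infinitely (P : nat -> Prop) := forall N, exists2 n, (N <= n)%N & P n.

Lemma finite_set_bounded (A : set (nat * nat)) :
  finite_set A -> exists N, forall p, A p -> (p.1 < N)%N.
Proof.
move=> /finite_seqP[s ->]; exists (\max_(p <- s) p.1).+1 => p ps.
by rewrite ltnS; apply: (@leq_bigmax_seq _ _ xpredT (fun p : nat * nat => p.1)).
Qed.

Definition graph (f : nat -> nat) : set (nat * nat) := [set p | p.2 = f p.1].

Lemma graph_infinite f : graph f #= [set: nat].
Proof.
apply/eq_card_nat; first exact: countableP.
move=> /finite_set_bounded[N /(_ (N, f N))] /=.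
by rewrite ltnn => /(_ erefl).
Qed.

Lemma graph_meet_infinite f B :
  ~ finite_set (graph f `&` B) -> ex_infinitely (fun n => B (n, f n)).
Proof.
move=> inf N; apply: contrapT => H; apply: inf.
apply: (@sub_finite_set _ _ ((fun n => (n, f n)) @` `I_N)).
  move=> [n m] [/= + Bn] => mE; rewrite /graph/= in mE; subst m.
  exists n => //=; rewrite ltnNge.
  by apply/negP => Nn; apply: H; exists n.
exact/finite_image/finite_II.
Qed.

Lemma ED_slalom B : ED B -> exists (u : nat -> nat -> nat) k,
  \forall n \near \oo, forall m, B (n, m) -> exists2 l, (l < k)%N & u n l = m.
Proof.
move=> [k Bk].
have /choice[u Hu] : forall n, exists v : nat -> nat,
    [set m | B (n, m)] #<= `I_k ->
    forall m, B (n, m) -> exists2 l, (l < k)%N & v l = m.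
  move=> n.
  have [le|] := pselect ([set m | B (n, m)] #<= `I_k); last by exists id.
  have /pcard_surjP[v vsurj] := le; exists v => _ m Bm.
  by have [l lk <-] := vsurj _ Bm; exists l.
by exists u, k; apply: filterS Bk => n Bn; exact: Hu.
Qed.

(* At each [n] the functions [e j l] with [j, l <= n] offer only finitely many
   guesses, the same ones for every [i] in [C]. *)
Definition captured {I : Type} (C : set I) := forall f : I -> nat -> nat,
  exists e : nat -> nat -> nat -> nat, forall i, C i ->
    ex_infinitely (fun n =>
      exists j l, [/\ (j <= n)%N, (l <= n)%N & f i n = e j l n]).

(** The graphs of the [f i] are too few to form a non-star family, so each has infinite intersection
    with a member of one countable part of [ED]; [e j l n] is the [l]-th point in column [n] of the
    [j]-th member. *)
Lemma captured_of_no_small_family (I : Type) (C : set I) :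
  ~ (exists2 F, non_star_omega_family ED F & F #<= C) -> captured C.
Proof.
move=> noF f; pose F := (graph \o f) @` C.
have [BB [BBED BBnat] Hit] : exists2 BB, countably_infinite_subsets ED BB &
    forall i, C i -> exists2 B, BB B & ~ finite_set (graph (f i) `&` B).
  apply: contrapT => H; apply: noF; exists F; last exact: card_image_le.
  split=> [_ [i Ci <-]|BB cBB]; first by split => //; exact: graph_infinite.
  apply: contrapT => H'; apply: H; exists BB => // i Ci.
  apply: contrapT => H''; apply: H'; exists (graph (f i)); first by exists i.
  by move=> B BBB; apply: contrapT => nf; apply: H''; exists B.
have [b bsurj] : exists b : nat -> set (nat * nat), BB `<=` range b.
  have : BB #<= [set: nat] by move: BBnat; rewrite card_eq_le => /andP[].
  by move=> /pcard_surjP[b bs]; exists b.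
have /choice[e He] : forall j, exists v : nat -> nat -> nat,
    ED (b j) -> exists k, \forall n \near \oo, forall m, b j (n, m) ->
    exists2 l, (l < k)%N & v l n = m.
  move=> j.
  have [/ED_slalom[u [k Hu]]|] := pselect (ED (b j)); last by exists (fun _ _ => 0%N).
  by exists (fun l n => u n l) => _; exists k.
exists e => i Ci N.
have [B BBB /graph_meet_infinite inf] := Hit _ Ci.
have [j _ bj] := bsurj _ BBB; move: BBB inf; rewrite -bj => /BBED /He[k [M _ HM]] inf.
(* Beyond [j] and [k] both indices of the guess are at most [n]. *)
have [n nN bn] := inf (maxn N (maxn M (maxn j k))).
move: nN; rewrite !geq_max => /and4P[Nn Mn jn kn].
exists n => //.
have [l lk el] := HM _ Mn _ bn.
by exists j, l; split => //; exact: leq_trans (ltnW lk) kn.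
Qed.

(** * Sequences that outgrow given functions *)

Definition running_max (h : nat -> nat) (n : nat) := \max_(m < n.+1) h m.

Lemma running_max_ge h n : (h n <= running_max h n)%N.
Proof. exact: (leq_bigmax (ord_max : 'I_n.+1)). Qed.

Lemma running_max_homo h : {homo running_max h : m n / (m <= n)%N}.
Proof.
move=> m n mn; apply/bigmax_leqP => i _.
by have := @leq_bigmax _ (fun j : 'I_n.+1 => h j) (widen_ord (mn : m.+1 <= n.+1)%N i).
Qed.

Lemma captured_unbounded (I : Type) (C : set I) (f : I -> nat -> nat) :
  captured C ->
  exists h : nat -> nat, forall i, C i -> ex_infinitely (fun n => (f i n <= h n)%N).
Proof.
move=> /(_ f)[e He]; exists (fun n => \max_(j < n.+1) \max_(l < n.+1) e j l n).
move=> i Ci N; have [n Nn [j [l [jn ln fE]]]] := He _ Ci N.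
exists n; rewrite //= fE.
apply: (@leq_trans (\max_(l < n.+1) e j l n)).
  exact: (@leq_bigmax _ (fun l : 'I_n.+1 => e j l n) (Ordinal (ln : l < n.+1)%N)).
exact: (@leq_bigmax _ (fun j : 'I_n.+1 => \max_(l < n.+1) e j l n)
  (Ordinal (jn : j < n.+1)%N)).
Qed.

(* If the conclusion fails for the iterates [u k] of [h'], then
   [h n <= h' (u k.+1) = u k.+2 < G (G n)] whenever [u k <= n < u k.+1], so [h]
   is dominated by [G \o G]. *)
Lemma captured_sequence (I : Type) (C : set I) (f : I -> nat -> nat) :
  captured C ->
  exists u : nat -> nat, (forall k, (u k < u k.+1)%N) /\
    forall i, C i -> ex_infinitely (fun k => (f i (u k) <= u k.+1)%N).
Proof.
move=> cC; pose G i n := running_max (f i) n.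
have [h Hh] := @captured_unbounded _ _ (fun i n => G i (G i n)) cC.
(* The summand [n.+1] makes the iterates strictly increasing. *)
pose h' n := (running_max h n + n.+1)%N.
have h'mono : {homo h' : m n / (m <= n)%N}.
  by move=> m n mn; rewrite leq_add ?running_max_homo.
pose u k := iter k h' 0%N.
have uS k : (u k < u k.+1)%N by rewrite /u iterS; exact: leq_addl.
have umono : {homo u : m n / (m <= n)%N}.
  by apply: homo_leq => [//||k]; [exact: leq_trans|exact: ltnW].
exists u; split => // i Ci K; apply: contrapT => H.
have fbig k : (K <= k)%N -> (u k.+1 < G i (u k))%N.
  move=> Kk; apply: (@leq_trans (f i (u k))); last exact: running_max_ge.
  by rewrite ltnNge; apply/negP => ?; apply: H; exists k.
have [n Kn Hn] := Hh _ Ci (u K).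
have [k /andP[Kk nk]] : exists k, (K <= k)%N && (u k <= n < u k.+1)%N.
  have uge k : (k <= u k)%N by elim: k => // k IH; apply: leq_ltn_trans (uS k).
  have exk : exists k, (n < u k)%N by exists n.+1; exact: uge.
  case: (ex_minnP exk) => -[|k] nuk kmin; first by [].
  exists k; rewrite nuk andbT; apply/andP; split; last first.
    by rewrite leqNgt; apply/negP => /kmin; rewrite ltnn.
  rewrite -ltnS ltnNge; apply/negP => /umono uKk.
  by have := leq_trans nuk (leq_trans uKk Kn); rewrite ltnn.
case/andP: nk => ukn nuk.
have : (h n < G i (G i n))%N.
  apply: (@leq_ltn_trans (u k.+2)).
    rewrite /u iterS -/(u k.+1); apply: leq_trans (h'mono _ _ (ltnW nuk)).
    by rewrite /h'; apply: leq_trans (running_max_ge _ _) (leq_addr _ _).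
  apply: leq_trans (fbig _ (leqW Kk)) _.
  apply: running_max_homo; apply: leq_trans (ltnW (fbig _ Kk)) _.
  exact: running_max_homo.
by rewrite ltnNge Hn.
Qed.

(** * Guessing partial functions *)

Lemma ex_infinitely_seq (P : nat -> Prop) (N s : nat) : ex_infinitely P ->
  exists ks : seq nat,
    [/\ uniq ks, size ks = s & forall k, k \in ks -> (N <= k)%N /\ P k].
Proof.
move=> inf; elim: s => [|s [ks [uks <- ksP]]]; first by exists [::].
have [k kN Pk] := inf (maxn N (\max_(j <- ks) j).+1).
move: kN; rewrite geq_max => /andP[Nk mk].
exists (k :: ks); split => //=.
  rewrite uks andbT; apply/negP => kks; move: mk; rewrite ltnNge.
  by rewrite (@leq_bigmax_seq _ ks xpredT id).
by move=> j; rewrite inE => /predU1P[->//|/ksP].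
Qed.

Section greedy.
Context {T : countType} (task : nat -> seq (nat * T)).

Fixpoint greedy (m : nat) : seq (nat * T) :=
  if m is m'.+1 then
    take 1 [seq p <- task m' | p.1 \notin unzip1 (greedy m')] ++ greedy m'
  else [::].

Lemma greedy_size m : (size (greedy m) <= m)%N.
Proof.
elim: m => //= m IH; rewrite size_cat -[m.+1]add1n leq_add//.
by rewrite size_take; case: ltnP.
Qed.

Lemma greedy_uniq m : uniq (unzip1 (greedy m)).
Proof.
elim: m => //= m IH.
case E : [seq p <- _ | _] => [//|p s] /=; rewrite take0 /= IH andbT.
have : p \in [seq p <- task m | p.1 \notin unzip1 (greedy m)] by rewrite E mem_head.
by rewrite mem_filter => /andP[].
Qed.

Lemma greedy_sub m n : (m <= n)%N -> {subset greedy m <= greedy n}.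
Proof.
move=> /subnK <-; elim: (n - m)%N => //= d IH p /IH pd.
by rewrite mem_cat pd orbT.
Qed.

(** Any two stages lie in a common later one, whose keys are distinct. *)
Lemma greedy_functional : exists g : nat -> option T,
  forall m k v, (k, v) \in greedy m -> g k = Some v.
Proof.
suff /choice[g Hg] : forall k, exists o : option T,
    forall m v, (k, v) \in greedy m -> o = Some v.
  by exists g => m k v; exact: Hg.
move=> k; have [[v [m kv]]|nov] := pselect (exists v m, (k, v) \in greedy m).
  exists (Some v) => m' v' kv'; congr Some.
  have {}kv := greedy_sub _ _ (leq_maxl m m') _ kv.
  have {}kv' := greedy_sub _ _ (leq_maxr m m') _ kv'.
  elim: (greedy _) (greedy_uniq (maxn m m')) kv kv' => //= -[k0 v0] s IH.
  move=> /andP[/= k0s us]; rewrite !inE.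
  move=> /predU1P[[e1 e2]|kvs] /predU1P[[e1' e2']|kvs'].
  - by rewrite e2 e2'.
  - by move: k0s; rewrite -e1 => /negP[]; apply/mapP; exists (k, v').
  - by move: k0s; rewrite -e1' => /negP[]; apply/mapP; exists (k, v).
  - exact: IH.
by exists None => m v kv; exfalso; apply: nov; exists v, m.
Qed.

(** At most [m] keys are taken before this task, fewer than it offers. *)
Lemma greedy_meets m : uniq (unzip1 (task m)) -> (m < size (task m))%N ->
  exists2 p, p \in task m & p \in greedy m.+1.
Proof.
move=> ut st /=; case E : [seq p <- _ | _] => [|p s].
  have sub : {subset unzip1 (task m) <= unzip1 (greedy m)}.
    move=> _ /mapP[p pt ->]; apply: contraT => np.
    by have := in_nil p; rewrite -E mem_filter np pt.
  have := uniq_leq_size ut sub; rewrite !size_map leqNgt.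
  by rewrite (leq_ltn_trans (greedy_size m) st).
exists p; last by rewrite /= mem_head.
have : p \in [seq p <- task m | p.1 \notin unzip1 (greedy m)] by rewrite E mem_head.
by rewrite mem_filter => /andP[].
Qed.

End greedy.

(* The guessed objects are lists of [(b n).+1] values of [f i] on [X i], so long
   that each guess keeps a key not used by the guesses treated before it. *)
Lemma captured_partial (I : Type) (C : set I) (T : countType)
    (X : I -> nat -> Prop) (f : I -> nat -> T) :
  captured C -> (forall i, C i -> ex_infinitely (X i)) ->
  exists g : nat -> option T,
    forall i, C i -> ex_infinitely (fun k => X i k /\ g k = Some (f i k)).
Proof.
move=> cC Xinf.
(* The guess [(n, j, l)] is treated as the task numbered by its code; [b n] bounds these codes, so
   [(b n).+1] keys suffice. *)
pose b n := \max_(j < n.+1) \max_(l < n.+1) pickle (n, (j : nat), (l : nat)).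
have bP n j l : (j <= n)%N -> (l <= n)%N -> (pickle (n, j, l) <= b n)%N.
  move=> jn ln; apply: (@leq_trans (\max_(l < n.+1) pickle (n, j, (l : nat)))).
    exact: (@leq_bigmax _ (fun l : 'I_n.+1 => pickle (n, j, (l : nat)))
      (Ordinal (ln : l < n.+1)%N)).
  exact: (@leq_bigmax _ (fun j : 'I_n.+1 => \max_(l < n.+1)
    pickle (n, (j : nat), (l : nat))) (Ordinal (jn : j < n.+1)%N)).
have /choice[L HL] : forall z : I * nat, exists L : seq (nat * T), C z.1 ->
    [/\ uniq (unzip1 L), size L = (b z.2).+1 & forall p, p \in L ->
      [/\ (z.2 <= p.1)%N, X z.1 p.1 & p.2 = f z.1 p.1]].
  move=> [i n] /=; have [Ci|nCi] := pselect (C i); last by exists [::].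
  have [ks [uks sks ksP]] := @ex_infinitely_seq _ n (b n).+1 (Xinf _ Ci).
  exists [seq (k, f i k) | k <- ks] => _; split.
  - by rewrite /unzip1 -map_comp map_id_in.
  - by rewrite size_map.
  - by move=> _ /mapP[k /ksP[nk Xk] ->].
have [e He] := cC (fun i n => pickle (L (i, n))).
pose task m : seq (nat * T) :=
  if @unpickle (nat * nat * nat)%type m is Some (n, j, l) then
    odflt [::] (unpickle (e j l n)) else [::].
have [g gP] := greedy_functional task.
exists g => i Ci N; have [n Nn [j [l [jn ln eL]]]] := He _ Ci N.
have [uL sL LP] := HL (i, n) Ci.
have taskE : task (pickle (n, j, l)) = L (i, n).
  by rewrite /task pickleK -eL pickleK.
have [||[k v] pL pg] := @greedy_meets _ task (pickle (n, j, l)).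
- by rewrite taskE.
- by rewrite taskE sL ltnS bP.
move: pL; rewrite taskE => /LP[/= nk Xk vE].
exists k; first exact: leq_trans nk.
by rewrite -vE; split => //; exact: gP pg.
Qed.

(** * Nested intervals avoiding meager sets *)

Local Open Scope ring_scope.

(** Rational endpoints allow indexing by [nat], so that intervals can be guessed as numbers; the
    default [(0, 1)] is nondegenerate. *)
Lemma exists_interval_base (R : realType) : exists a b : nat -> R,
  (forall i, a i < b i) /\
  (forall x y, x < y -> exists i, x <= a i /\ b i <= y).
Proof.
pose c i : R * R := if unpickle i is Some (p, q) then
  if ratr p < ratr q :> R then (ratr p, ratr q) else (0, 1) else (0, 1).
exists (fst \o c), (snd \o c); split=> [i|x y xy] /=.
  rewrite /c; case: unpickle => [[p q]|] /=; last exact: ltr01.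
  by case: ifP => //= _; exact: ltr01.
have [p] := rat_in_itvoo xy; rewrite in_itv/= => /andP[xp py].
have [q] := rat_in_itvoo py; rewrite in_itv/= => /andP[pq qy].
by exists (pickle (p, q)); rewrite /c pickleK pq/=; split; apply: ltW.
Qed.

Lemma nowhere_dense_avoid (R : realType) (N : set R) (x y : R) :
  nowhere_dense N -> x < y ->
  exists u v, [/\ x <= u, u < v, v <= y & forall z, u <= z <= v -> ~ N z].
Proof.
move=> ndN xy.
have [z xzy Nz] : exists2 z, `]x, y[%classic z & ~ closure N z.
  apply: contrapT => H.
  have sub : `]x, y[%classic `<=` closure N.
    by move=> z xzy; apply: contrapT => Nz; apply: H; exists z.
  have : interior (closure N) ((x + y) / 2).
    apply: filterS sub _; apply: open_nbhs_nbhs; split; first exact: itv_open.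
    by rewrite /= in_itv/=; apply/andP; split; lra.
  by rewrite ndN.
have : nbhs z (`]x, y[ `&` ~` closure N).
  apply: open_nbhs_nbhs; split => //; apply: openI; first exact: itv_open.
  by apply: closed_openC; exact: closed_closure.
move=> /nbhs_ballP[e /= e0 He].
(* Half the radius keeps a closed interval inside the open ball. *)
have bz w : z - e / 2 <= w <= z + e / 2 -> (`]x, y[ `&` ~` closure N) w.
  by move=> /andP[w1 w2]; apply: He; rewrite /ball/= ltr_norml; apply/andP; split; lra.
exists (z - e / 2), (z + e / 2); split.
- have [|+ _] := bz (z - e / 2); first by apply/andP; split; lra.
  by rewrite /= in_itv/= => /andP[/ltW].
- lra.
- have [|+ _] := bz (z + e / 2); first by apply/andP; split; lra.
  by rewrite /= in_itv/= => /andP[_ /ltW].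
- by move=> w /bz[_ nc] Nw; apply: nc; exact: subset_closure.
Qed.

Lemma nowhere_dense_seq_avoid (R : realType) (N : nat -> set R) (k : nat) (x y : R) :
  (forall i, nowhere_dense (N i)) -> x < y ->
  exists u v, [/\ x <= u, u < v, v <= y &
    forall z, u <= z <= v -> forall l, (l < k)%N -> ~ N l z].
Proof.
move=> ndN xy; elim: k => [|k [u [v [xu uv vy Huv]]]]; first by exists x, y.
have [u' [v' [uu' uv' vv' Huv']]] := @nowhere_dense_avoid _ _ _ _ (ndN k) uv.
exists u', v'; split => //; [exact: le_trans uu'|exact: le_trans vy|].
move=> z /andP[u'z zv'] l; rewrite ltnS leq_eqVlt => /predU1P[->|lk].
  by apply: Huv'; rewrite u'z.
by apply: Huv => //; rewrite (le_trans uu')// (le_trans zv').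
Qed.

(* [d (M, k, i)] is a subinterval of the [i]-th base interval that avoids
   [N M 0, ..., N M k]. Along [u], the restriction of [d (M, k, _)] to
   [i <= u k] has values [<= u k.+1] for infinitely many [k], and [g] guesses it
   at infinitely many of these. The nested intervals [q k] follow the guesses of
   [g], whatever [M] is. *)
Lemma captured_not_cover (R : realType) (C : set (set R)) :
  captured C -> ~ meager_cover C.
Proof.
move=> cC [Cmeager Ccover].
have [a [b [ab abP]]] := exists_interval_base R.
have /choice[N HN] : forall M : set R, exists N : nat -> set R,
    C M -> (forall i, nowhere_dense (N i)) /\ M = \bigcup_i N i.
  move=> M; have [/Cmeager[N HN]|] := pselect (C M); first by exists N.
  by exists (fun _ => set0).
have /choice[d Hd] : forall z : set R * nat * nat, exists j, C z.1.1 ->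
    [/\ a z.2 <= a j, b j <= b z.2 &
      forall w, a j <= w <= b j -> forall l, (l <= z.1.2)%N -> ~ N z.1.1 l w].
  move=> [[M k] i] /=; have [CM|nCM] := pselect (C M); last by exists 0%N.
  have [ndN _] := HN _ CM.
  have [u [v [au uv vb Huv]]] := @nowhere_dense_seq_avoid _ _ k.+1 _ _ ndN (ab i).
  have [j [uj jv]] := abP _ _ uv.
  exists j => _; split; [exact: le_trans uj|exact: le_trans vb|].
  by move=> w /andP[jw wj]; apply: Huv; rewrite (le_trans uj)// (le_trans wj).
(* Since [k <= u k], a bound on [F M (u k)] bounds every [d (M, k, i)] with [i <= u k]. *)
pose F M n := \max_(k < n.+1) \max_(i < n.+1) d (M, k : nat, i : nat).
have FP M n k i : (k <= n)%N -> (i <= n)%N -> (d (M, k, i) <= F M n)%N.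
  move=> kn iN; apply: (@leq_trans (\max_(i < n.+1) d (M, k, i : nat))).
    exact: (@leq_bigmax _ (fun i : 'I_n.+1 => d (M, k, i : nat))
      (Ordinal (iN : i < n.+1)%N)).
  exact: (@leq_bigmax _ (fun k : 'I_n.+1 => \max_(i < n.+1) d (M, k : nat, i : nat))
    (Ordinal (kn : k < n.+1)%N)).
have [u [uS uP]] := @captured_sequence _ _ F cC.
have uge k : (k <= u k)%N by elim: k => // k IH; apply: leq_ltn_trans (uS k).
have [g gP] := @captured_partial _ _ (seq nat) _
  (fun M k => mkseq (fun i => d (M, k, i)) (u k).+1) cC uP.
pose next k i := nth 0%N (odflt [::] (g k)) i.
(* A guess is followed only if it gives a subinterval whose index is at most [u k.+1], hence within
   the table to be guessed at [k.+1]. *)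
pose ok k i := [&& (next k i <= u k.+1)%N, a i <= a (next k i) & b (next k i) <= b i].
pose q := fix q k :=
  if k is k'.+1 then if ok k' (q k') then next k' (q k') else q k' else 0%N.
have qu k : (q k <= u k)%N.
  elim: k => //= k IH; case: ifP => [/and3P[]//|_].
  exact: leq_trans IH (ltnW (uS k)).
have aq : {homo a \o q : m n / (m <= n)%N >-> m <= n}.
  apply: homo_leq => [//||k /=]; first exact: le_trans.
  by case: ifP => // /and3P[].
have bq : {homo b \o q : m n / (m <= n)%N >-> n <= m}.
  apply: homo_leq => [//|y x z xy yz|k /=]; first exact: le_trans yz xy.
  by case: ifP => // /and3P[].
have abq m n : a (q m) <= b (q n).
  apply: (le_trans (aq _ _ (leq_maxl m n))).
  by apply: le_trans (bq _ _ (leq_maxr m n)); exact/ltW/ab.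
pose y := sup (range (a \o q)).
have yin k : a (q k) <= y <= b (q k).
  apply/andP; split.
    apply: ub_le_sup; last by exists k.
    by exists (b (q 0%N)) => _ [n _ <-]; exact: abq.
  by apply: ge_sup; [exists (a (q 0%N)), 0%N|move=> _ [n _ <-]; exact: abq].
have [M CM My] : (\bigcup_(M in C) M) y by rewrite Ccover.
have [_ ME] := HN _ CM; move: My; rewrite {1}ME => -[l _ Nly].
have [k lk [Xk gk]] := gP _ CM l.
have nextE : next k (q k) = d (M, k, q k).
  by rewrite /next gk /= nth_mkseq// ltnS.
have [ad bd dN] := Hd (M, k, q k) CM.
(* A correct guess passes the test, so the next interval avoids [N M l]. *)
have okk : ok k (q k).
  rewrite /ok nextE ad bd !andbT; apply: leq_trans Xk; exact: FP.
have qE : q k.+1 = d (M, k, q k) by rewrite /= okk.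
by have := yin k.+1; rewrite qE => /dN /(_ _ lk).
Qed.

(** * From non-star families to meager covers *)

(* [digits x] is the graph of the partial function sending [n] to
   [floor (1 / frac ((n + 1) x)) - 1]. *)
Definition digits (R : realType) (x : R) : set (nat * nat) :=
  [set p | exists k : int,
    k%:~R + p.2.+2%:R^-1 < p.1.+1%:R * x < k%:~R + p.2.+1%:R^-1].

(** [k] must be the floor of [(n + 1) x], and the intervals from [1 / (m + 2)] to [1 / (m + 1)] are
    disjoint. *)
Lemma digits_functional (R : realType) (x : R) n m m' :
  digits R x (n, m) -> digits R x (n, m') -> m = m'.
Proof.
have inv01 (i : nat) : 0 < i.+1%:R^-1 :> R /\ i.+1%:R^-1 <= 1 :> R.
  by rewrite invr_gt0 ltr0n invf_le1 ?ltr0n// ler1n.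
have floorE (k : int) (t : R) i : k%:~R + i.+2%:R^-1 < t < k%:~R + i.+1%:R^-1 ->
    Num.floor t = k.
  move=> /andP[kt tk]; apply: floor_def; rewrite intrD -[1%:~R]/(1 : R).
  move: kt tk (inv01 i.+1).1 (inv01 i).2.
  move: (i.+2%:R^-1 : R) (i.+1%:R^-1 : R) => p q kt tk p0 q1.
  by apply/andP; split; lra.
move=> [k /= km] [k' /= km'].
have ? : k' = k by rewrite -(floorE _ _ _ km) -(floorE _ _ _ km').
subst k'; case/andP: km => km mk; case/andP: km' => km' mk'.
suff lt i j : k%:~R + i.+2%:R^-1 < n.+1%:R * x -> n.+1%:R * x < k%:~R + j.+1%:R^-1 ->
    (j <= i)%N.
  by apply/eqP; rewrite eqn_leq (lt m' m)// (lt m m').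
move=> ik kj; rewrite -ltnS.
have : i.+2%:R^-1 < j.+1%:R^-1 :> R by have := lt_trans ik kj; rewrite ltrD2l.
by rewrite ltf_pV2 ?posrE ?ltr0n// ltr_nat.
Qed.

(** The added columns will force a set almost disjoint from all of these to have finite columns. *)
Lemma digits_column_ED (R : realType) (x : R) j :
  ED (digits R x `|` [set p | p.1 = j]).
Proof.
exists 1%N; exists j.+1 => // n /= jn.
have [[m0 Bm0]|no] := pselect (exists m, digits R x (n, m)).
  apply: (@card_le_trans _ _ _ [set m0]).
    apply: subset_card_le => m [Bm|/= nj]; first exact: (digits_functional _ _ _ _ _ Bm Bm0).
    by move: jn; rewrite nj ltnn.
  by have := @card_set1 _ m0; rewrite card_eq_le => /andP[].
rewrite (_ : [set m | _] = set0); first exact: card_ge0.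
apply/seteqP; split => // m [Bm|/= nj]; first by apply: no; exists m.
by move: jn; rewrite nj ltnn.
Qed.

(** As [digits x] has at most one point per column, the union over [N] consists of the [x] for which
    [A] and [digits x] meet in a finite set. *)
Definition avoiders (R : realType) (A : set (nat * nat)) (N : nat) : set R :=
  [set x | forall p, A p -> (N <= p.1)%N -> ~ digits R x p].

(* Every interval of length more than [2 / n] contains an interval on which the
   [n]-th digit is [m], for every [m]. *)
Lemma avoiders_nowhere_dense (R : realType) (A : set (nat * nat)) (N : nat) :
  (forall K, exists2 p, A p & (K <= p.1)%N) -> nowhere_dense (avoiders R A N).
Proof.
move=> Ainf; apply/seteqP; split => // z.
rewrite /interior /= => /nbhs_ballP[e /= e0 ze].
have [[n m] Anm] := Ainf (maxn N (Num.truncn e^-1)).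
rewrite geq_max => /= /andP[Nn en].
have ne : n.+1%:R^-1 < e.
  rewrite -[e]invrK ltf_pV2 ?posrE ?invr_gt0//.
  apply: lt_le_trans (truncnS_gt _) _; rewrite ler_nat//.
pose k := Num.floor (n.+1%:R * z).
pose p : R := m.+2%:R^-1; pose q : R := m.+1%:R^-1.
have p0 : 0 < p by rewrite invr_gt0 ltr0n.
have pq : p < q by rewrite ltf_pV2 ?posrE ?ltr0n// ltr_nat.
have q1 : q <= 1 by rewrite invf_le1 ?ltr0n// ler1n.
(* [(n + 1) y] is the midpoint of the interval for digit [m] above [k]; it is within 1 of
   [(n + 1) z], while [(n + 1) e > 1]. *)
pose y : R := (k%:~R + (p + q) / 2) / n.+1%:R.
have ny : n.+1%:R * y = k%:~R + (p + q) / 2.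
  by rewrite /y mulrC divfK// pnatr_eq0.
have bzy : ball z e y.
  rewrite /ball/= -(@ltr_pM2l _ n.+1%:R) ?ltr0n//.
  rewrite -[X in X * `|_|]ger0_norm// -normrM mulrBr ny.
  have /andP[kz zk] := floor_itv (n.+1%:R * z).
  rewrite -/k intrD -[1%:~R]/(1 : R) in kz zk.
  have ne1 : 1 < n.+1%:R * e.
    by rewrite -(@ltr_pM2l _ n.+1%:R^-1) ?invr_gt0 ?ltr0n// mulr1 mulKf// pnatr_eq0.
  clearbody p q; apply: lt_trans ne1.
  by rewrite ltr_norml; apply/andP; split; lra.
pose V : set R := [set w | k%:~R + p < n.+1%:R * w < k%:~R + q].
have nV : nbhs y V.
  apply: open_nbhs_nbhs; split.
    rewrite (_ : V = ( *%R n.+1%:R) @^-1` `]k%:~R + p, k%:~R + q[%classic).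
      by apply: open_comp => [w _|]; [exact: mulrl_continuous|exact: itv_open].
    by apply/seteqP; split => w; rewrite /V/= in_itv.
  by rewrite /V/= ny; clearbody p q; apply/andP; split; lra.
have [w [Ew Vw]] := ze _ bzy _ nV.
by apply: (Ew _ Anm Nn); exists k.
Qed.

Lemma meager_cover_of_family (R : realType) (F : set (set (nat * nat))) :
  non_star_omega_family ED F ->
  exists2 C : set (set R), meager_cover C & C #<= F.
Proof.
move=> [Finf Fhit].
pose M A : set R := \bigcup_N avoiders R A N.
(* If [A] lies in finitely many columns, [M A] is the whole line; hence only meager [M A] are
   kept. *)
exists ((M @` F) `&` [set X | meager X]); last first.
  by apply: card_le_trans (card_image_le M F); apply: subset_card_le; exact: subIsetl.
split=> [X []//|]; apply/seteqP; split => // x _.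
pose B j := digits R x `|` [set p | p.1 = j].
(* Distinctness makes the family of the [B j] infinite, as the property of [F] demands. *)
have Binj : injective B.
  move=> i j Bij.
  have H m : digits R x (i, m) \/ i = j.
    have : B j (i, m) by rewrite -Bij; right.
    by case=> [|/= ->]; [left|right].
  have [H0|//] := H 0%N; have [H1|//] := H 1%N.
  by have := digits_functional _ _ _ _ _ H0 H1.
have [|A FA HA] := Fhit (range B).
  split=> [_ [j _ <-]|]; first exact: digits_column_ED.
  by apply: inj_card_eq => i j _ _; exact: Binj.
have [_ Anat] := Finf _ FA.
have Ainf : infinite_set A by apply/infiniteP; move: Anat; rewrite card_eq_le => /andP[].
(* Otherwise finitely many columns cover [A], each meeting it in a finite set. *)
have Acol K : exists2 p, A p & (K <= p.1)%N.
  apply: contrapT => H; apply: Ainf.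
  apply: (@sub_finite_set _ _ (\bigcup_(j in `I_K) (A `&` B j))).
    move=> p Ap; exists p.1 => /=; last by split => //; right.
    by rewrite ltnNge; apply/negP => Kp; apply: H; exists p.
  by apply: bigcup_finite => // j _; apply: HA; exists j.
have [N HN] := finite_set_bounded _ (HA _ (ex_intro2 _ _ 0%N I erefl)).
exists (M A); last first.
  by exists N => // p Ap Np dp; have := HN _ (conj Ap (or_introl dp)); rewrite ltnNge Np.
split; first by exists A.
by exists (avoiders R A); split => // i; exact: avoiders_nowhere_dense.
Qed.

(** * Equality of the two cardinals *)

Lemma family_of_meager_cover (R : realType) (C : set (set R)) :
  meager_cover C -> exists2 F, non_star_omega_family ED F & F #<= C.
Proof.
by move=> Ccover; apply: contrapT => /captured_of_no_small_family/captured_not_cover.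
Qed.

Lemma nowhere_dense_set1 (R : realType) (x : R) : nowhere_dense [set x].
Proof.
by rewrite /nowhere_dense -(closure_id [set x]).1 ?interior_set1.
Qed.

Theorem proposition3p34 (R : realType) :
  exists kappa : Type, is_non_star_omega ED kappa /\ is_cov_meager R kappa.
Proof.
apply: is_min_card_transfer.
(* Singletons are meager, so all meager sets together form a cover, which yields some family. *)
- have [|F famF _] := @family_of_meager_cover R [set X | meager X]; last by exists F.
  split=> //; apply/seteqP; split => // x _; exists [set x] => //.
  exists (fun=> [set x]); split; last by rewrite bigcup_const//; exists 0%N.
  by move=> _; exact: nowhere_dense_set1.
- exact: meager_cover_of_family.
- exact: family_of_meager_cover.
Qed.
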